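(* Let $T\subseteq\Pi_n$ be a lower set and let $P$ be a probability measure on $\mathbb{R}^n$ with Fourier transform $\hat P=f$. Then $T[P]=0$ if and only if the function $f$ satisfies the functional equation $$\sum_{\pi\in T}\mu(\pi,\hat{\mathbf{1}}_n)f_\pi(t)=0,\qquad t\in\mathbb{R}^n,$$ where $f_\pi(t)=\prod_{i=1}^{|\pi|}f(t_{F_i},\vec{0})$ for $\pi=(F_1,\dots,F_{|\pi|})$.
   Context: $\Pi_n$ denotes the set of all partitions of $\{1,\dots,n\}$ into nonempty disjoint blocks, ordered by refinement: $\pi\le\sigma$ iff every block of $\pi$ is contained in a block of $\sigma$; $|\pi|$ is the number of blocks; $\hat{\mathbf{0}}_n$ is the partition into singletons and $\hat{\mathbf{1}}_n$ the one-block partition. A lower set of $\Pi_n$ is a subset $T$ containing $\hat{\mathbf 0}_n$ and $\hat{\mathbf 1}_n$ such that $w\in T\setminus\{\hat{\mathbf 1}_n\}$, $z\in\Pi_n$, $z\le w$ imply $z\in T$. With the induced order, $\mu$ is the M\''obius function of the poset $T$: $\mu(x,x)=1$, $\mu(x,y)=-\sum_{z\in T,\,x\le z<y}\mu(x,z)$ for $x<y$ in $T$, $0$ otherwise. Probability measures on $\mathbb{R}^n$ are Borel (Radon). For nonempty $F\subseteq\{1,\dots,n\}$, $P_F$ is the marginal of $P$ on $\mathbb{R}^F$; for $\pi=(F_1,\dots,F_\ell)$, $P_\pi:=P_{F_1}\times\cdots\times P_{F_\ell}$, viewed as a measure on $\mathbb{R}^n$; $T[P]:=\sum_{\pi\in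 T}\mu(\pi,\hat{\mathbf{1}}_n)P_\pi$. The Fourier transform is $\hat P(t)=\int_{\mathbb{R}^n}e^{-i\langle t,\xi\rangle}dP(\xi)$. For $t\in\mathbb{R}^n$ and $F\subseteq\{1,\dots,n\}$, the vector $(t_F,\vec{0})\in\mathbb{R}^n$ agrees with $t$ on the coordinates in $F$ and is zero on the coordinates outside $F$. *)

(* Defs.v *)
From HB Require Import structures.
From mathcomp Require Import all_boot all_order all_algebra.

Set Implicit Arguments.
Unset Strict Implicit.
Unset Printing Implicit Defensive.

Import Order.TTheory GRing.Theory Num.Theory.

Local Open Scope ring_scope.

(** * Moebius function of a finite poset

    [T] is a subset of a finite poset [U], with the induced order.  The first
    argument of [mobius_rec] is fuel: each recursive call removes at
    least one element from the part of [T] below [y], so [#|T|] steps are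
    enough (see [mobiusE]). *)

Fixpoint mobius_rec (d : Order.disp_t) (U : finPOrderType d) (T : {set U})
    (k : nat) (x y : U) : int :=
  if k is k'.+1 then
    if x == y then 1
    else if (x < y)%O then
      - \sum_(z in T | (x <= z < y)%O) mobius_rec T k' x z
    else 0
  else 0.

Definition mobius (d : Order.disp_t) (U : finPOrderType d) (T : {set U})
    (x y : U) : int := mobius_rec T #|T| x y.

Section mobius_theory.
Context (d : Order.disp_t) (U : finPOrderType d) (T : {set U}).

Lemma mobius_rec_fuel k x y : y \in T ->
  (#|[set z in T | (z <= y)%O]| <= k)%N ->
  mobius_rec T k x y = mobius_rec T k.+1 x y.
Proof.
elim: k x y => [|k IHk] x y yT.
  rewrite leqn0 cards_eq0 => /eqP/setP/(_ y).
  by rewrite !inE yT lexx.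
move=> ck; rewrite [LHS]/= [RHS]/=.
case: ifP => // _; case: ifP => // _.
congr (- _); apply: eq_bigr => z /and3P[zT xz zy].
apply: IHk => //; rewrite -ltnS; apply: leq_trans ck.
apply/proper_card/properP; split.
  apply/subsetP => w; rewrite !inE => /andP[-> wz] /=.
  exact: le_trans wz (ltW zy).
by exists y; rewrite !inE yT ?lexx//= lt_geF.
Qed.

Lemma mobiusE x y : y \in T ->
  mobius T x y =
    if x == y then 1
    else if (x < y)%O then - \sum_(z in T | (x <= z < y)%O) mobius T x z
    else 0.
Proof.
move=> yT; rewrite {1}/mobius mobius_rec_fuel//.
by apply/subset_leq_card/subsetP => z; rewrite inE => /andP[].
Qed.

End mobius_theory.

(** * Set partitions, ordered by refinement *)

Record setpart (n : nat) := SetPart {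
  blocks :> {set {set 'I_n}};
  setpartP : partition blocks [set: 'I_n] }.

HB.instance Definition _ n := [isSub for @blocks n].
HB.instance Definition _ n := [Finite of setpart n by <:].

Definition refines n (pi sigma : setpart n) : bool :=
  [forall F in blocks pi, [exists G in blocks sigma, F \subset G]].

Lemma refinesP n (pi sigma : setpart n) :
  reflect (forall F, F \in blocks pi ->
             exists2 G, G \in blocks sigma & F \subset G)
          (refines pi sigma).
Proof.
apply: (iffP forall_inP) => h F /h; first by case/exists_inP => G ? ?; exists G.
by case=> G ? ?; apply/exists_inP; exists G.
Qed.

Lemma refines_refl n : reflexive (@refines n).
Proof. by move=> pi; apply/refinesP => F Fpi; exists F. Qed.

Lemma refines_trans n : transitive (@refines n).
Proof.
move=> sigma pi tau /refinesP h1 /refinesP h2; apply/refinesP => F /h1[G].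
by move=> /h2[H Htau GH] FG; exists H => //; exact: subset_trans GH.
Qed.

Lemma refines_sub n (pi sigma : setpart n) :
  refines pi sigma -> refines sigma pi -> blocks pi \subset blocks sigma.
Proof.
move=> /refinesP h1 /refinesP h2; apply/subsetP => F Fpi.
have /and3P[_ tI n0] := setpartP pi.
have [G Gs FG] := h1 _ Fpi; have [H Hpi GH] := h2 _ Gs.
have [FH|FH] := eqVneq F H.
  suff -> : F = G by [].
  by apply/eqP; rewrite eqEsubset FG/= FH.
have dFH := trivIsetP tI _ _ Fpi Hpi FH.
have F0 : F == set0.
  by rewrite -(setIidPl (subset_trans FG GH)) setI_eq0.
by rewrite (eqP F0) (negPf n0) in Fpi.
Qed.

Lemma refines_anti n : antisymmetric (@refines n).
Proof.
move=> pi sigma /andP[h1 h2]; apply/val_inj/eqP.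
by rewrite eqEsubset; apply/andP; split; exact: refines_sub.
Qed.

Fact setpart_display : Order.disp_t. Proof. exact: Order.Disp tt tt. Qed.

HB.instance Definition _ n := Order.Le_isPOrder.Build setpart_display
  (setpart n) (@refines_refl n) (@refines_anti n) (@refines_trans n).

Lemma hat0_subproof n : partition [set [set i] | i : 'I_n] [set: 'I_n].
Proof.
apply/and3P; split.
- apply/eqP/setP => i; rewrite inE; apply/bigcupP.
  by exists [set i]; rewrite ?set11// imset_f.
- apply/trivIsetP => _ _ /imsetP[i _ ->] /imsetP[j _ ->] ij.
  rewrite disjoints1 inE; apply: contraNneq ij => ->.
  by [].
- by apply/imsetP => -[i _ /setP/(_ i)]; rewrite !inE eqxx.
Qed.

Lemma hat1_subproof n : partition ([set [set: 'I_n]] :\ set0) [set: 'I_n].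
Proof.
apply/and3P; split; last by rewrite !inE eqxx.
- apply/eqP/setP => i; rewrite inE; apply/bigcupP.
  exists [set: 'I_n]; rewrite !inE// eqxx andbT.
  by apply/eqP => /setP/(_ i); rewrite !inE.
- apply/trivIsetP => A B; rewrite !inE => /andP[_ /eqP->] /andP[_ /eqP->].
  by rewrite eqxx.
Qed.

Definition hat0 n : setpart n := SetPart (hat0_subproof n).

(** Removing [set0] only matters for [n = 0], where [setT] is empty and hence
    not a block. *)
Definition hat1 n : setpart n := SetPart (hat1_subproof n).

Definition lower_set n (T : {set setpart n}) : Prop :=
  [/\ hat0 n \in T, hat1 n \in T &
      forall w z : setpart n,
        w \in T -> w != hat1 n -> (z <= w)%O -> z \in T].

From mathcomp Require Import all_classical all_reals all_analysis complex.
Import numFieldNormedType.Exports.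

Local Open Scope classical_set_scope.
Local Open Scope complex_scope.
Local Open Scope ring_scope.

(** * Product measures indexed by set partitions

    R^n is [n.-tuple R] with the product of the Borel sigma-algebras of the
    coordinates, which is the Borel sigma-algebra of R^n; R^F is
    [#|F|.-tuple R], its coordinates being listed in the order of [enum F]. *)

Section measures.
Context (R : realType) (n : nat).
Implicit Types (F : {set 'I_n}) (P : probability (n.-tuple R) R).

Definition proj F (x : n.-tuple R) : #|F|.-tuple R :=
  [tuple tnth x (enum_val i) | i < #|F|].

Lemma measurable_proj F : measurable_fun [set: n.-tuple R] (proj F).
Proof.
apply/measurable_fun_tnthP => i.
rewrite (_ : _ \o _ = fun x : n.-tuple R => tnth x (enum_val i)).
  exact: measurable_tnth.
by apply/funext => x /=; rewrite tnth_mktuple.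
Qed.

HB.instance Definition _ F := isMeasurableFun.Build _ _ _ _
  (proj F) (@measurable_proj F).

Definition marginal P F : probability (#|F|.-tuple R) R :=
  distribution P (proj F).

(** The vector whose coordinates in [F] come from [p.1] and whose other
    coordinates come from [p.2]: for [i \notin F] the index below is out of
    range and the default value of [nth] is returned. *)
Definition merge F (p : #|F|.-tuple R * n.-tuple R) : n.-tuple R :=
  [tuple nth (tnth p.2 i) p.1 (index i (enum F)) | i < n].

Lemma measurable_merge F :
  measurable_fun [set: #|F|.-tuple R * n.-tuple R] (merge (F := F)).
Proof.
apply/measurable_fun_tnthP => i.
have [lt_iF|ge_iF] := ltnP (index i (enum F)) #|F|.
  rewrite (_ : _ \o _ = (@tnth _ R ^~ (Ordinal lt_iF)) \o fst).
    by apply: measurableT_comp => //; exact: measurable_tnth.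
  by apply/funext => p /=; rewrite tnth_mktuple; exact/esym/tnth_nth.
rewrite (_ : _ \o _ = (@tnth _ R ^~ i) \o snd).
  by apply: measurableT_comp => //; exact: measurable_tnth.
by apply/funext => p /=; rewrite tnth_mktuple nth_default// size_tuple.
Qed.

HB.instance Definition _ F := isMeasurableFun.Build _ _ _ _
  (merge (F := F)) (@measurable_merge F).

(** The product of the marginals [P_F], [F] ranging over [s], with each factor
    placed on the coordinates in [F]; coordinates outside the blocks of [s]
    are set to 0 (there are none when [s] enumerates a partition of ['I_n]). *)
Fixpoint prod_marginals P (s : seq {set 'I_n}) : probability (n.-tuple R) R :=
  if s is F :: s' then
    distribution (marginal P F \x prod_marginals P s')%E (merge (F := F))
  else @dirac _ (n.-tuple R) [tuple (0 : R) | _ < n] R.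

(** [P_pi], viewed as a measure on R^n; see [partition_measure_rect]. *)
Definition partition_measure P (pi : setpart n) : probability (n.-tuple R) R :=
  prod_marginals P (enum (blocks pi)).

Let cyl m (D : pred 'I_m) (A : 'I_m -> set R) : set (m.-tuple R) :=
  [set x | forall i, D i -> A i (tnth x i)].

Let measurable_cyl m (D : pred 'I_m) (A : 'I_m -> set R) :
  (forall i, measurable (A i)) -> measurable (cyl D A).
Proof.
move=> mA.
rewrite (_ : cyl D A = \bigcap_(i in [set i | D i]) ((@tnth _ R ^~ i) @^-1` A i)); last first.
  by apply/seteqP; split => x h i Di; exact: h.
apply: fin_bigcap_measurable; first exact: finite_finset.
by move=> i _; rewrite -[X in measurable X]setTI; exact: measurable_tnth.
Qed.

Lemma prod_marginals_rect P (s : seq {set 'I_n}) (A : 'I_n -> set R) :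
    (forall i, measurable (A i)) ->
    uniq s -> finset.trivIset [set F in s]%SET ->
  prod_marginals P s [set x | forall i, has (fun F => i \in F) s -> A i (tnth x i)] =
  (\prod_(F <- s) P [set x | forall i, i \in F -> A i (tnth x i)])%E.
Proof.
move=> mA; elim: s => [|F s IHs] /=.
  move=> _ _; rewrite big_nil /dirac/= indicE mem_set//.
move=> /andP[Fs us] tI; rewrite big_cons -IHs//; last first.
  by apply: finset.trivIsetS tI; apply/fintype.subsetP => G; rewrite !inE => ->; rewrite orbT.
have dis i G : i \in F -> G \in s -> i \in G -> False.
  move=> iF Gs iG.
  have FG : F != G by apply: contraNneq Fs => ->.
  have := finset.trivIsetP tI F G; rewrite !inE eqxx Gs orbT => /(_ isT isT FG).
  by move=> /pred0P/(_ i)/=; rewrite iF iG.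
rewrite /distribution /pushforward.
rewrite (_ : _ @^-1` _ =
  cyl predT (fun k : 'I_#|F| => A (enum_val k)) `*`
  cyl (fun i => has (fun F => i \in F) s) A); last first.
  apply/seteqP; split => -[x y] /= h.
    split => /= [k _|i hi].
      have := h (enum_val k); rewrite enum_valP /= => /(_ isT).
      rewrite tnth_mktuple (_ : index _ _ = k); last first.
        by rewrite (enum_val_nth (enum_val k)) index_uniq ?enum_uniq// -cardE.
      by rewrite -tnth_nth.
    have := h i; rewrite hi orbT => /(_ isT).
    rewrite tnth_mktuple /= nth_default// size_tuple cardE leqNgt index_mem mem_enum.
    by apply/negP => iF; case/hasP: hi => G Gs iG; exact: dis iF Gs iG.
  case: h => /= h1 h2 i; rewrite tnth_mktuple/=.
  have [iF _|iF /= hi] := boolP (i \in F).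
    have h := h1 (enum_rank_in iF i) isT.
    rewrite enum_rankK_in// in h.
    rewrite (_ : index _ _ = enum_rank_in iF i); last first.
      by rewrite -{1}(enum_rankK_in iF iF) (enum_val_nth i) index_uniq ?enum_uniq// -cardE.
    by rewrite -tnth_nth.
  by rewrite nth_default; [exact: h2|rewrite size_tuple cardE leqNgt index_mem mem_enum].
have -> : forall B C, measurable B -> measurable C ->
  (marginal P F \x prod_marginals P s)%E (B `*` C) = (marginal P F B * prod_marginals P s C)%E.
- by move=> B C mB mC; exact: product_measure1E.
- congr (_ * _)%E; rewrite /marginal /distribution /pushforward; congr (P _).
  apply/seteqP; split => x /= h i.
    move=> iF; have := h (enum_rank_in iF i) isT.
    by rewrite tnth_mktuple enum_rankK_in.
  by move=> _; rewrite tnth_mktuple; apply: h; exact: enum_valP.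
- exact: measurable_cyl.
- exact: measurable_cyl.
Qed.

Lemma partition_measure_rect P (pi : setpart n) (A : 'I_n -> set R) :
    (forall i, measurable (A i)) ->
  partition_measure P pi [set x | forall i, A i (tnth x i)] =
  (\prod_(F in blocks pi) P [set x | forall i, i \in F -> A i (tnth x i)])%E.
Proof.
move=> mA; have /and3P[/eqP cov tI _] := setpartP pi.
rewrite -[RHS]big_enum -prod_marginals_rect ?enum_uniq//; last first.
  by rewrite (_ : [set F in _]%SET = blocks pi)//; apply/finset.setP => F; rewrite !inE mem_enum.
rewrite /partition_measure; congr (prod_marginals _ _ _).
apply/seteqP; split => x h i //; apply: h.
have : i \in finset.cover (blocks pi) by rewrite cov inE.
by case/finset.bigcupP => F Fpi iF; apply/hasP; exists F; rewrite ?mem_enum.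
Qed.

(** The signed measure [T[P]]. *)
Definition lower_set_measure (T : {set setpart n}) P (A : set (n.-tuple R)) :
    \bar R :=
  (\sum_(pi in T) ((mobius T pi (hat1 n))%:~R)%:E * partition_measure P pi A)%E.

End measures.

(** * Fourier transforms *)

Section fourier.
Context (R : realType) (n : nat).
Implicit Types (t : n.-tuple R) (f : n.-tuple R -> R[i]).

Definition cexp (z : R[i]) : R[i] :=
  (expR (Re z))%:C * (cos (Im z) +i* sin (Im z)).

Definition Cintegral d (X : measurableType d) (mu : {measure set X -> \bar R})
    (g : X -> R[i]) : R[i] :=
  (\int[mu]_x Re (g x)) +i* (\int[mu]_x Im (g x)).

Definition dotp t (x : n.-tuple R) : R := \sum_(i < n) tnth t i * tnth x i.

Definition fourier (P : probability (n.-tuple R) R) t : R[i] :=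
  Cintegral P (fun x => cexp (- 'i * (dotp t x)%:C)).

(** The vector [(t_F, 0)]. *)
Definition zero_outside (F : {set 'I_n}) t : n.-tuple R :=
  [tuple if i \in F then tnth t i else 0 | i < n].

(** [f_pi] *)
Definition partition_fun f (pi : setpart n) t : R[i] :=
  \prod_(F in blocks pi) f (zero_outside F t).

End fourier.

(* Main.v *)
Require Import Defs.
From mathcomp Require Import all_boot all_order all_algebra.
From mathcomp Require Import all_classical all_reals all_analysis complex.
From mathcomp Require Import finmap measurable_realfun ring lra.

Set Implicit Arguments.
Unset Strict Implicit.
Unset Printing Implicit Defensive.

Import Order.TTheory GRing.Theory Num.Theory.
Import numFieldNormedType.Exports.

Local Open Scope classical_set_scope.
Local Open Scope ring_scope.

(** Both sides of the equivalence say that the signed measure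
    [nu = \sum_(pi in T) mu(pi, hat1) P_pi] vanishes: the left one on
    measurable sets, the right one on the characters [exp(-i <t, x>)].  Two
    facts are needed.

    First, the function [f_pi] is the Fourier transform of [P_pi]
    ([fourier_partition_measure]): on a product measure the integral of a
    character splits by Fubini's theorem into one factor per block, and the
    Fourier transform of a marginal [P_F] at [t_F] is the one of [P] at
    [(t_F, 0)].  So the functional equation says that [nu] integrates the
    functions [cos <t, x>] and [sin <t, x>] to zero, for all [t].

    Second, a signed measure with zero Fourier transform is zero
    ([signed_fourier_uniqueness]); the converse ([signed_integral_eq0]) is
    approximation by simple functions.  The uniqueness theorem is proved without
    inversion formula or smoothing.  Let a bounded function be annihilated if
    its product with any character has zero [nu]-integral, and let a
    multiplier be a bounded function [h] such that [g h] is annihilated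
    whenever [g] is.  Multipliers form an algebra, they are closed under bounded
    pointwise limits by dominated convergence, and they contain all [cos <s, x>]
    and [sin <s, x>] by the product-to-sum formulas.  Iterating the polynomial
    [y (3 - y^2) / 2] turns values in [[-1, 1]] into their signs, hence
    [sg (sin ((x_i - a) / m))] is a multiplier, and letting [m] tend to infinity
    so is [sg (x_i - a)].  Thus indicators of half-spaces [a < x_i] are
    multipliers.  The sets whose indicator is a multiplier form a sigma-algebra,
    so they include all measurable sets; multiplying the constant 1, which is
    annihilated by assumption, by such an indicator gives [nu A = 0]. *)

(** * Bounded functions and signed combinations of probabilities *)

Import HBNNSimple.

Section signed_integral.
Context d (X : measurableType d) (R : realType).

Definition bounded_measurable (g : X -> R) : Prop :=
  measurable_fun [set: X] g /\ exists M : R, forall x, `|g x| <= M.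

Lemma bounded_measurable_cst (a : R) : bounded_measurable (fun=> a).
Proof. by split; [exact: measurable_cst|exists `|a|]. Qed.

Lemma bounded_measurableD (g h : X -> R) :
  bounded_measurable g -> bounded_measurable h ->
  bounded_measurable (fun x => g x + h x).
Proof.
move=> [mg [M gM]] [mh [N hN]]; split; first exact: measurable_funD.
by exists (M + N) => x; rewrite (le_trans (ler_normD _ _))// lerD.
Qed.

Lemma bounded_measurableM (g h : X -> R) :
  bounded_measurable g -> bounded_measurable h ->
  bounded_measurable (fun x => g x * h x).
Proof.
move=> [mg [M gM]] [mh [N hN]]; split; first exact: measurable_funM.
by exists (M * N) => x; rewrite normrM ler_pM.
Qed.

Lemma bounded_measurable_indic (A : set X) :
  measurable A -> bounded_measurable \1_A.
Proof.
move=> mA; split; first exact: measurable_indic.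
by exists 1 => x; rewrite indicE ger0_norm ?ler0n// lern1 leq_b1.
Qed.

Lemma bounded_measurable_integrable (P : probability X R) (g : X -> R) :
  bounded_measurable g -> P.-integrable [set: X] (EFin \o g).
Proof.
move=> [mg [M gM]]; apply: measurable_bounded_integrable => //.
  by rewrite fin_num_fun_lty//; exact: fin_num_measure.
by exists M; split; [exact: num_real|move=> N MN x _ /=; exact: le_trans (gM x) (ltW MN)].
Qed.

(** Dominated convergence, the constant [M] being integrable for a probability. *)
Lemma Rintegral_cvg (P : probability X R) (h : nat -> X -> R) (g : X -> R)
    (M : R) :
    (forall k, measurable_fun [set: X] (h k)) ->
    (forall k x, `|h k x| <= M) -> (forall x, h k x @[k --> \oo] --> g x) ->
  \int[P]_x h k x @[k --> \oo] --> \int[P]_x g x.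
Proof.
move=> mh hM hg.
have mg : measurable_fun [set: X] g.
  by apply: (measurable_fun_cvg mh) => x _; exact: hg.
have [] := @dominated_convergence _ X R P setT measurableT
  (fun k x => (h k x)%:E) (EFin \o g) (cst M%:E).
- by move=> k; exact/measurable_EFinP.
- exact/measurable_EFinP.
- by apply: aeW => x _ /=; apply/fine_cvgP; split; [exact: nearW|exact: hg].
- exact: finite_measure_integrable_cst.
- by apply: aeW => x k _ /=; rewrite lee_fin.
move=> ig _; rewrite -(@fineK _ (\int[P]_x (g x)%:E)%E).
  exact: fine_cvg.
exact: integrable_fin_num.
Qed.

Context (J : finType) (S : {set J}) (c : J -> R) (P : J -> probability X R).

(** The integral of [g] against the signed measure [\sum_(i in S) c i P i],
    for bounded [g]. *)
Definition signed_integral (g : X -> R) : R :=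
  \sum_(i in S) c i * \int[P i]_x g x.

Lemma signed_integralD g h : bounded_measurable g -> bounded_measurable h ->
  signed_integral (fun x => g x + h x) = signed_integral g + signed_integral h.
Proof.
move=> bg bh; rewrite -big_split; apply: eq_bigr => i _ /=.
have ig := bounded_measurable_integrable (P i) bg.
have ih := bounded_measurable_integrable (P i) bh.
by rewrite (RintegralD measurableT ig ih) mulrDr.
Qed.

Lemma signed_integralZ a g : bounded_measurable g ->
  signed_integral (fun x => a * g x) = a * signed_integral g.
Proof.
move=> bg; rewrite mulr_sumr; apply: eq_bigr => i _ /=.
have ig := bounded_measurable_integrable (P i) bg.
by rewrite (RintegralZl a measurableT ig) mulrCA.
Qed.

Lemma signed_integral_cvg0 (h : nat -> X -> R) (g : X -> R) (M : R) :
    (forall k, measurable_fun [set: X] (h k)) ->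
    (forall k x, `|h k x| <= M) -> (forall x, h k x @[k --> \oo] --> g x) ->
  (forall k, signed_integral (h k) = 0) -> signed_integral g = 0.
Proof.
move=> mh hM hg h0.
have : signed_integral (h k) @[k --> \oo] --> signed_integral g.
  rewrite /signed_integral; apply: cvg_big => [|i _]; first exact: add_continuous.
  by apply: cvgMl_tmp; exact: Rintegral_cvg mh hM hg.
move/cvg_lim => <-//; under eq_fun do rewrite h0.
exact: lim_cst.
Qed.

Lemma signed_integral_indic (A : set X) : measurable A ->
  (signed_integral \1_A)%:E = (\sum_(i in S) (c i)%:E * P i A)%E.
Proof.
move=> mA; rewrite /signed_integral -sumEFin; apply: eq_bigr => i _.
rewrite EFinM /Rintegral integral_indic// setIT fineK//.
exact: fin_num_measure.
Qed.

Lemma signed_integral_sum (K : Type) (s : seq K) (h : K -> X -> R) :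
  (forall j, bounded_measurable (h j)) ->
  bounded_measurable (fun x => \sum_(j <- s) h j x) /\
  signed_integral (fun x => \sum_(j <- s) h j x) =
  \sum_(j <- s) signed_integral (h j).
Proof.
move=> bh; elim: s => [|j s [bs IHs]].
  under eq_fun do rewrite big_nil.
  split; first exact: bounded_measurable_cst.
  rewrite big_nil (_ : (fun _ => 0) = fun x => 0 * (fun=> 0) x); last first.
    by apply/funext => x; rewrite mul0r.
  by rewrite signed_integralZ ?mul0r//; exact: bounded_measurable_cst.
under eq_fun do rewrite big_cons.
split; first exact: bounded_measurableD.
by rewrite signed_integralD// big_cons IHs.
Qed.

(** A nonnegative bounded function is the limit of simple functions below it,
    which are combinations of indicators; a general one is shifted by a bound. *)
Lemma signed_integral_eq0 (g : X -> R) :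
    (forall A, measurable A -> (\sum_(i in S) (c i)%:E * P i A)%E = 0%E) ->
  bounded_measurable g -> signed_integral g = 0.
Proof.
move=> PA0.
have indic0 A : measurable A -> signed_integral \1_A = 0.
  by move=> mA; apply: EFin_inj; rewrite signed_integral_indic// PA0.
have pos0 h : bounded_measurable h -> (forall x, 0 <= h x) ->
    signed_integral h = 0.
  move=> [mh [M hM]] h0.
  have mEh : measurable_fun setT (EFin \o h) by exact/measurable_EFinP.
  pose f := nnsfun_approx measurableT mEh.
  apply: (signed_integral_cvg0 (h := fun k x => f k x) (M := M)).
  - by move=> k; exact: measurable_funP.
  - move=> k x; rewrite ger0_norm//.
    apply: le_trans (le_trans (ler_norm _) (hM x)).
    have fk_cvg : f n x @[n --> \oo] --> h x.
      have := @cvg_nnsfun_approx _ _ _ _ measurableT _ mEh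
        (fun x _ => h0 x) x I.
      by move/fine_cvgP => [].
    rewrite -(cvg_lim _ fk_cvg)//; apply: nondecreasing_cvgn_le.
      move=> m n mn; exact/lefP/nd_nnsfun_approx.
    exact: cvgP fk_cvg.
  - move=> x.
    have := @cvg_nnsfun_approx _ _ _ _ measurableT _ mEh
      (fun x _ => h0 x) x I.
    by move/fine_cvgP => [].
  - move=> k.
    have b1 y : bounded_measurable \1_(f k @^-1` [set y]).
      exact: bounded_measurable_indic.
    rewrite (_ : (f k : X -> R) = fun x =>
        \sum_(y <- fset_set (range (f k))) y * \1_(f k @^-1` [set y]) x).
      rewrite (signed_integral_sum _ _).2 => [|y].
        by rewrite big1// => y _; rewrite signed_integralZ// indic0 ?mulr0.
      by apply: bounded_measurableM => //; exact: bounded_measurable_cst.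
    by apply/funext => x; rewrite fimfunE fsbig_finite.
move=> [mg [M gM]].
have bM := bounded_measurable_cst `|M|.
have gM0 x : 0 <= g x + `|M|.
  rewrite -lerBlDr sub0r; apply: (lerNnormlW _).
  exact: le_trans (gM x) (ler_norm _).
have := pos0 _ (bounded_measurableD (conj mg (ex_intro _ M gM)) bM) gM0.
rewrite signed_integralD//; last by split => //; exists M.
by rewrite (pos0 _ bM) ?addr0.
Qed.

End signed_integral.

(** * The sign function as a limit of polynomials in sines *)

Lemma normr_cvg_le (R : realType) (u : nat -> R) (l M : R) :
  u k @[k --> \oo] --> l -> (forall k, `|u k| <= M) -> `|l| <= M.
Proof.
move=> ul uM; have nul : `|u k| @[k --> \oo] --> `|l| by exact: cvg_norm.
by rewrite -(cvg_lim _ nul)//; apply: limr_le; [exact: cvgP nul|exact: nearW].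
Qed.

Section sign_approximation.
Context (R : realType).
Implicit Types y : R.

(** The graph passes through the fixed points -1, 0, 1, of which only -1 and 1
    are attracting, and [[-1, 1]] is stable. *)
Definition sharpen y : R := y * (3 - y ^+ 2) / 2.

Lemma sharpenN y : sharpen (- y) = - sharpen y.
Proof. by rewrite /sharpen; ring. Qed.

Lemma iter_sharpenN k y : iter k sharpen (- y) = - iter k sharpen y.
Proof. by elim: k => //= k ->; rewrite sharpenN. Qed.

Lemma iter_sharpen0 k : iter k sharpen 0 = 0.
Proof. by elim: k => //= k ->; rewrite /sharpen mul0r mul0r. Qed.

(** The iterates increase, because [1 - sharpen z] is [1 - z] times
    [(1 - z) (1 + z / 2)]; that factor is at most [1 - y / 2] for [z >= y], whence
    geometric convergence to 1. *)
Lemma iter_sharpen_bounds k y : 0 < y <= 1 ->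
  y <= iter k sharpen y <= 1 /\ 1 - iter k sharpen y <= (1 - y / 2) ^+ k.
Proof.
move=> /andP[y0 y1]; elim: k => [|k [/andP[]]] /=.
  by rewrite lexx y1 expr0; split => //; lra.
set z := iter k sharpen y => yz z1 IH.
have zz : 1 - sharpen z = (1 - z) * (1 - z / 2 - z ^+ 2 / 2).
  by rewrite /sharpen; field.
have z2 : 0 <= z ^+ 2 <= 1 by rewrite sqr_ge0 expr_le1//; lra.
have p0 : 0 <= (1 - z) * (1 - z / 2 - z ^+ 2 / 2) by apply: mulr_ge0; lra.
have p1 : (1 - z) * (1 - z / 2 - z ^+ 2 / 2) <= (1 - z) * (1 - y / 2).
  by apply: ler_wpM2l; lra.
have p2 : (1 - z) * (1 - y / 2) <= (1 - y / 2) ^+ k * (1 - y / 2).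
  by apply: ler_wpM2r => //; lra.
have p3 : (1 - z) * (1 - y / 2) <= (1 - z) * 1 by apply: ler_wpM2l; lra.
by rewrite exprSr; split; [apply/andP; split|]; lra.
Qed.

Lemma iter_sharpen_cvg y : `|y| <= 1 ->
  iter k sharpen y @[k --> \oo] --> Num.sg y.
Proof.
have pos z : 0 < z <= 1 -> iter k sharpen z @[k --> \oo] --> (1 : R).
  move=> z01; have /andP[z0 z1] := z01.
  have g0 : 1 - (1 - z / 2) ^+ k @[k --> \oo] --> (1 : R).
    rewrite -[X in _ --> X]subr0; apply: cvgB; first exact: cvg_cst.
    by apply: cvg_expr; rewrite ger0_norm; lra.
  apply: (@squeeze_cvgr _ _ _ _ (fun k => 1 - (1 - z / 2) ^+ k) (cst (1 : R)));
    [|exact: g0|exact: cvg_cst].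
  apply: nearW => k.
  by have [/andP[? ?] ?] := iter_sharpen_bounds k z01; apply/andP; split => //=; lra.
rewrite ler_norml => /andP[yN1 y1].
have [y0|y0|->] := ltrgt0P y.
- by rewrite gtr0_sg//; apply: pos; rewrite y0.
- rewrite ltr0_sg// -[y]opprK; under eq_fun do rewrite iter_sharpenN.
  by apply: cvgN; apply: pos; lra.
- by rewrite sgr0; under eq_fun do rewrite iter_sharpen0; exact: cvg_cst.
Qed.

Lemma iter_sharpen_norm_le1 k y : `|y| <= 1 -> `|iter k sharpen y| <= 1.
Proof.
have pos z : 0 < z <= 1 -> `|iter k sharpen z| <= 1.
  move=> z01; have /andP[z0 z1] := z01.
  have [/andP[zk k1] _] := iter_sharpen_bounds k z01.
  by rewrite ger0_norm// (le_trans _ zk)// ltW.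
rewrite ler_norml => /andP[yN1 y1].
have [y0|y0|->] := ltrgt0P y.
- by apply: pos; rewrite y0.
- by rewrite -[y]opprK iter_sharpenN normrN; apply: pos; lra.
- by rewrite iter_sharpen0 normr0.
Qed.

Lemma sgr_sin (u : R) : `|u| < pi -> Num.sg (sin u) = Num.sg u.
Proof.
rewrite ltr_norml => /andP[uN u1].
have [u0|u0|->] := ltrgt0P u; last by rewrite sin0.
- by rewrite !gtr0_sg// sin_gt0_pi// u0.
- rewrite (ltr0_sg u0) ltr0_sg// -[u]opprK sinN oppr_lt0 sin_gt0_pi//.
  by apply/andP; split; lra.
Qed.

(** The sequence is eventually constant: the sine has the sign of its argument
    on [(-pi, pi)]. *)
Lemma sgr_sin_cvg (u : R) :
  Num.sg (sin (m.+1%:R^-1 * u)) @[m --> \oo] --> Num.sg u.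
Proof.
apply: cvg_near_cst; near=> m.
have m0 : 0 < m.+1%:R^-1 :> R by rewrite invr_gt0 ltr0n.
rewrite sgr_sin.
  by rewrite sgrM (gtr0_sg m0) mul1r.
rewrite normrM gtr0_norm// mulrC ltr_pdivrMr ?ltr0n// mulrC -ltr_pdivrMr ?pi_gt0//.
have : `|u| / pi < m%:R by near: m; exact: nbhs_infty_gtr.
by move/lt_trans; apply; rewrite ltr_nat.
Unshelve. all: end_near. Qed.

End sign_approximation.

(** * Uniqueness of the Fourier transform for signed measures *)

Section fourier_uniqueness.
Context (R : realType) (n : nat) (J : finType) (S : {set J}) (c : J -> R).
Context (P : J -> probability (n.-tuple R) R).

Let L := signed_integral S c P.

Lemma measurable_dotp (t : n.-tuple R) :
  measurable_fun [set: n.-tuple R] (dotp t).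
Proof.
rewrite /dotp; apply: measurable_sum => i.
by apply: measurable_funM => //; exact: measurable_tnth.
Qed.

Lemma bounded_measurable_cos (t : n.-tuple R) :
  bounded_measurable (fun x => cos (dotp t x)).
Proof.
split; last by exists 1 => x; rewrite ler_norml cos_geN1 cos_le1.
apply: measurableT_comp (measurable_dotp t).
by apply: continuous_measurable_fun; exact: continuous_cos.
Qed.

Lemma bounded_measurable_sin (t : n.-tuple R) :
  bounded_measurable (fun x => sin (dotp t x)).
Proof.
split; last by exists 1 => x; rewrite ler_norml sin_geN1 sin_le1.
apply: measurableT_comp (measurable_dotp t).
by apply: continuous_measurable_fun; exact: continuous_sin.
Qed.

(** The signed measure with density [g] has zero Fourier transform. *)
Definition annihilated (g : n.-tuple R -> R) : Prop :=
  bounded_measurable g /\ forall t,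
    L (fun x => g x * cos (dotp t x)) = 0 /\
    L (fun x => g x * sin (dotp t x)) = 0.

(** Asking for a property of all products [g h], rather than only of [h], makes
    stability under products immediate and stability under limits a matter of
    dominated convergence in one factor. *)
Definition multiplier (h : n.-tuple R -> R) : Prop :=
  bounded_measurable h /\
  forall g, annihilated g -> annihilated (fun x => g x * h x).

Lemma annihilatedD g1 g2 : annihilated g1 -> annihilated g2 ->
  annihilated (fun x => g1 x + g2 x).
Proof.
move=> [b1 a1] [b2 a2]; split; first exact: bounded_measurableD.
move=> t; have [c1 s1] := a1 t; have [c2 s2] := a2 t.
have bc := bounded_measurable_cos t; have bs := bounded_measurable_sin t.
split; under eq_fun do rewrite mulrDl.
- by rewrite /L signed_integralD; first (by rewrite [X in X + _]c1 add0r);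
    exact: bounded_measurableM.
- by rewrite /L signed_integralD; first (by rewrite [X in X + _]s1 add0r);
    exact: bounded_measurableM.
Qed.

Lemma annihilatedZ a g : annihilated g -> annihilated (fun x => a * g x).
Proof.
move=> [b ag]; split.
  by apply: bounded_measurableM => //; exact: bounded_measurable_cst.
move=> t; have [c0 s0] := ag t.
have bc := bounded_measurable_cos t; have bs := bounded_measurable_sin t.
split; under eq_fun do rewrite -mulrA.
- by rewrite /L signed_integralZ ?[X in _ * X]c0 ?mulr0//; exact: bounded_measurableM.
- by rewrite /L signed_integralZ ?[X in _ * X]s0 ?mulr0//; exact: bounded_measurableM.
Qed.

Lemma annihilated_cvg (h : nat -> n.-tuple R -> R)
    (g : n.-tuple R -> R) (M : R) :
    (forall k, annihilated (h k)) -> (forall k x, `|h k x| <= M) ->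
  (forall x, h k x @[k --> \oo] --> g x) -> annihilated g.
Proof.
move=> ah hM hg; have mh k : measurable_fun setT (h k) by case: (ah k) => -[].
have mg : measurable_fun setT g.
  by apply: (measurable_fun_cvg mh) => x _; exact: hg.
have gM x : `|g x| <= M by exact: normr_cvg_le (hg x) _.
have trig u : bounded_measurable u -> (forall x, `|u x| <= 1) ->
    (forall k, L (fun x => h k x * u x) = 0) -> L (fun x => g x * u x) = 0.
  move=> [mu _] u1; apply: (signed_integral_cvg0 (M := M)).
  - by move=> k; exact: measurable_funM.
  - move=> k x; rewrite normrM -[M]mulr1; apply: ler_pM => //.
  - by move=> x; apply: cvgMr_tmp; exact: hg.
split; first by split => //; exists M.
move=> t; split; apply: trig.
- exact: bounded_measurable_cos.
- by move=> x; rewrite ler_norml cos_geN1 cos_le1.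
- by move=> k; case: (ah k) => _ /(_ t)[].
- exact: bounded_measurable_sin.
- by move=> x; rewrite ler_norml sin_geN1 sin_le1.
- by move=> k; case: (ah k) => _ /(_ t)[].
Qed.

Lemma multiplier_cst a : multiplier (fun=> a).
Proof.
split; first exact: bounded_measurable_cst.
by move=> g ag; under eq_fun do rewrite mulrC; exact: annihilatedZ.
Qed.

Lemma multiplierD h1 h2 : multiplier h1 -> multiplier h2 ->
  multiplier (fun x => h1 x + h2 x).
Proof.
move=> [b1 m1] [b2 m2]; split; first exact: bounded_measurableD.
move=> g ag; under eq_fun do rewrite mulrDr.
by apply: annihilatedD; [exact: m1|exact: m2].
Qed.

Lemma multiplierM h1 h2 : multiplier h1 -> multiplier h2 ->
  multiplier (fun x => h1 x * h2 x).
Proof.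
move=> [b1 m1] [b2 m2]; split; first exact: bounded_measurableM.
by move=> g ag; under eq_fun do rewrite mulrA; apply: m2; exact: m1.
Qed.

Lemma multiplier_cvg (h : nat -> n.-tuple R -> R)
    (g : n.-tuple R -> R) (M : R) :
    (forall k, multiplier (h k)) -> (forall k x, `|h k x| <= M) ->
  (forall x, h k x @[k --> \oo] --> g x) -> multiplier g.
Proof.
move=> mh hM hg; have meas k : measurable_fun setT (h k) by case: (mh k) => -[].
split.
  split; first by apply: (measurable_fun_cvg meas) => x _; exact: hg.
  by exists M => x; exact: normr_cvg_le (hg x) _.
move=> u au; have [[_ [N uN]] _] := au.
apply: (annihilated_cvg (h := fun k x => u x * h k x) (M := N * M)).
- by move=> k; case: (mh k) => _; exact.
- by move=> k x; rewrite normrM; apply: ler_pM.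
- by move=> x; apply: cvgMl_tmp; exact: hg.
Qed.

(** Sums and differences of frequencies, which product-to-sum formulas need. *)
Lemma dotp_comb (a b : R) (s t x : n.-tuple R) :
  dotp [tuple a * tnth s i + b * tnth t i | i < n] x =
  a * dotp s x + b * dotp t x.
Proof.
rewrite /dotp !mulr_sumr -big_split; apply: eq_bigr => i _ /=.
by rewrite tnth_mktuple; ring.
Qed.

(** [(g cos <s, x>) cos <t, x>] is half the sum of [g cos <s + t, x>] and
    [g cos <s - t, x>], and similarly for the three other products. *)
Lemma multiplier_trig (s : n.-tuple R) :
  multiplier (fun x => cos (dotp s x)) /\ multiplier (fun x => sin (dotp s x)).
Proof.
have bc t := bounded_measurable_cos t; have bs t := bounded_measurable_sin t.
have comb a b (f1 f2 f : n.-tuple R -> R) :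
    bounded_measurable f1 -> bounded_measurable f2 ->
    L f1 = 0 -> L f2 = 0 -> (forall x, f x = a * f1 x + b * f2 x) -> L f = 0.
  move=> b1 b2 L1 L2 fE; rewrite (funext fE) /L signed_integralD.
  - by rewrite !signed_integralZ// -/(L f1) -/(L f2) L1 L2 !mulr0 addr0.
  - by apply: bounded_measurableM => //; exact: bounded_measurable_cst.
  - by apply: bounded_measurableM => //; exact: bounded_measurable_cst.
pose plus t := [tuple 1 * tnth s i + 1 * tnth t i | i < n].
pose minus t := [tuple 1 * tnth s i + (-1) * tnth t i | i < n].
have plusE t x : dotp (plus t) x = dotp s x + dotp t x.
  by rewrite dotp_comb !mul1r.
have minusE t x : dotp (minus t) x = dotp s x - dotp t x.
  by rewrite dotp_comb mul1r mulN1r.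
split; split=> // g [bg ag]; split; try exact: bounded_measurableM;
  move=> t; have [cp sp] := ag (plus t); have [cm sm] := ag (minus t); split.
- apply: (comb (2^-1) (2^-1) _ _ _ _ _ cp cm); try exact: bounded_measurableM.
  by move=> x; rewrite plusE minusE cosD cosB; field.
- apply: (comb (2^-1) (- 2^-1) _ _ _ _ _ sp sm); try exact: bounded_measurableM.
  by move=> x; rewrite plusE minusE sinD sinB; field.
- apply: (comb (2^-1) (2^-1) _ _ _ _ _ sp sm); try exact: bounded_measurableM.
  by move=> x; rewrite plusE minusE sinD sinB; field.
- apply: (comb (- 2^-1) (2^-1) _ _ _ _ _ cp cm); try exact: bounded_measurableM.
  by move=> x; rewrite plusE minusE cosD cosB; field.
Qed.

(** The iterates of [sharpen] at [h] are polynomials in [h]. *)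
Lemma multiplier_sg h : multiplier h -> (forall x, `|h x| <= 1) ->
  multiplier (fun x => Num.sg (h x)).
Proof.
move=> mh h1.
apply: (multiplier_cvg (h := fun k x => iter k (@sharpen R) (h x)) (M := 1)).
- elim=> [//|k IH] /=; rewrite /sharpen.
  apply: multiplierM; last exact: multiplier_cst.
  apply: multiplierM => //; apply: multiplierD; first exact: multiplier_cst.
  under eq_fun do rewrite -mulN1r expr2.
  by do !apply: multiplierM => //; exact: multiplier_cst.
- by move=> k x; exact: iter_sharpen_norm_le1.
- by move=> x; exact: iter_sharpen_cvg.
Qed.

(** The functions [sin ((x_i - a) / m)] are trigonometric polynomials with
    frequency along the [i]-th axis; their signs converge to that of [x_i - a]. *)
Lemma multiplier_sg_coord (i : 'I_n) (a : R) :
  multiplier (fun x => Num.sg (tnth x i - a)).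
Proof.
apply: (multiplier_cvg
  (h := fun m x => Num.sg (sin (m.+1%:R^-1 * (tnth x i - a)))) (M := 1)).
- move=> m; apply: multiplier_sg; last first.
    by move=> x; rewrite ler_norml sin_geN1 sin_le1.
  pose s : n.-tuple R := [tuple (m.+1%:R^-1 *+ (j == i)) | j < n].
  have sE x : dotp s x = m.+1%:R^-1 * tnth x i.
    rewrite /dotp (bigD1 i)//= big1 ?addr0 => [|j /negPf ji].
      by rewrite tnth_mktuple eqxx mulr1n.
    by rewrite tnth_mktuple ji mulr0n mul0r.
  under eq_fun do rewrite mulrBr -sE sinB -mulrN.
  have [mc ms] := multiplier_trig s.
  by apply: multiplierD; apply: multiplierM => //; exact: multiplier_cst.
- by move=> m x; rewrite normr_sg lern1 leq_b1.
- by move=> x; exact: sgr_sin_cvg.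
Qed.

(** The sign [u] alone takes the value 0 on the boundary; [(u^2 + u) / 2] is
    exactly the indicator of the open half-space. *)
Lemma multiplier_halfspace (i : 'I_n) (a : R) :
  multiplier \1_[set x : n.-tuple R | a < tnth x i].
Proof.
rewrite (_ : \1__ = fun x : n.-tuple R => 2^-1 *
    (Num.sg (tnth x i - a) * Num.sg (tnth x i - a) + Num.sg (tnth x i - a))).
  have ms := multiplier_sg_coord i a.
  apply: multiplierM; first exact: multiplier_cst.
  by apply: multiplierD => //; exact: multiplierM.
apply/funext => x; rewrite indicE /=.
have [xa|xa|->] := ltrgtP a (tnth x i).
- by rewrite mem_set// gtr0_sg ?subr_gt0// mulr1n; field.
- rewrite memNset ?ltr0_sg ?subr_lt0// ?mulr0n; first by ring.
  by move=> /=; rewrite ltNge (ltW xa).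
- rewrite memNset ?subrr ?sgr0 ?mulr0n; first by ring.
  by move=> /=; rewrite ltxx.
Qed.

(** Complements come from [1 - h]; a countable intersection is the pointwise
    limit of finite products of indicators. *)
Lemma multiplier_sigma_algebra :
  sigma_algebra [set: n.-tuple R] [set A | multiplier \1_A].
Proof.
have indicD (A : set (n.-tuple R)) : multiplier \1_A -> multiplier \1_(~` A).
  move=> mA; rewrite (_ : \1__ = fun x => 1 + -1 * \1_A x).
    apply: multiplierD; first exact: multiplier_cst.
    by apply: multiplierM => //; exact: multiplier_cst.
  by apply/funext => x; rewrite indicC indicE; case: (x \in A) => /=; ring.
split => /=.
- by rewrite indic0; exact: multiplier_cst.
- by move=> A mA; rewrite setTD; exact: indicD.
move=> F mF; rewrite -[X in multiplier \1_X]setCK; apply: (indicD).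
apply: (multiplier_cvg
  (h := fun k x => \prod_(j < k) \1_(~` F j) x) (M := 1)).
- elim=> [|k IH].
    by under eq_fun do rewrite big_ord0; exact: multiplier_cst.
  under eq_fun do rewrite big_ord_recr.
  by apply: multiplierM => //; exact: indicD.
- move=> k x; rewrite normr_prod; apply: prodr_ile1 => j _.
  by rewrite normr_ge0 indicE ger0_norm ?ler0n// lern1 leq_b1.
move=> x; apply: cvg_near_cst.
have [[j _ Fjx]|xF] := pselect ((\bigcup_j F j) x).
  rewrite indicE memNset; last by apply; exists j.
  exists j.+1 => //= k jk.
  by rewrite (bigD1 (Ordinal jk))//= indicE memNset ?mul0r//.
rewrite indicE mem_set//; apply: nearW => k; apply: big1 => j _.
by rewrite indicE mem_set// => Fj; apply: xF; exists j.
Qed.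

Lemma multiplier_measurable (A : set (n.-tuple R)) :
  measurable A -> multiplier \1_A.
Proof.
suff : measurable `<=` [set B : set (n.-tuple R) | multiplier \1_B] by exact.
apply: smallest_sub; first exact: multiplier_sigma_algebra.
rewrite -bigcup_seq => _ [i _ [B mB <-]]; rewrite setTI /=.
(* For fixed i, the sets B such that the cylinder over B is a multiplier form
   a sigma-algebra containing the rays, which generate the Borel sets. *)
pose C := [set B | multiplier \1_((@tnth n R ^~ i) @^-1` B)].
suff : (@ocitv R).-sigma.-measurable `<=` C by exact.
rewrite RGenOInfty.measurableE; apply: smallest_sub; last first.
  move=> _ [a ->]; rewrite /C /=.
  rewrite (_ : _ @^-1` _ = [set x | a < tnth x i]); first exact: multiplier_halfspace.
  by apply/seteqP; split => x /=; rewrite in_itv /= andbT.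
have [s0 sD sU] := multiplier_sigma_algebra.
split => /=.
- by rewrite /C/= preimage_set0.
- by move=> D; rewrite /C/= setTD preimage_setC => /sD; rewrite setTD.
- by move=> F mF; rewrite /C/= preimage_bigcup; exact: sU.
Qed.

(** The hypothesis says that the constant 1 is annihilated; so is then its
    product with the multiplier [\1_A], and testing against the character of
    frequency 0, which is constant, gives the measure of [A]. *)
Lemma signed_fourier_uniqueness :
    (forall t, L (fun x => cos (dotp t x)) = 0 /\
               L (fun x => sin (dotp t x)) = 0) ->
  forall A, measurable A -> (\sum_(j in S) (c j)%:E * P j A)%E = 0%E.
Proof.
move=> L0 A mA; rewrite -signed_integral_indic//; congr EFin.
have a1 : annihilated (fun=> 1).
  split; first exact: bounded_measurable_cst.
  move=> t; have [c0 s0] := L0 t; split; [rewrite -[RHS]c0|rewrite -[RHS]s0];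
    by congr L; apply/funext => x; rewrite mul1r.
have [_ /(_ [tuple 0 | _ < n])[LA _]] := (multiplier_measurable mA).2 _ a1.
rewrite -[RHS]LA; congr L; apply/funext => x; rewrite mul1r /dotp big1.
  by rewrite cos0 mulr1.
by move=> i _; rewrite tnth_mktuple mul0r.
Qed.

End fourier_uniqueness.

(** * Fourier transforms of products of marginals *)

Lemma Rintegral_distribution d d' (X : measurableType d) (Y : measurableType d')
    (R : realType) (P : probability X R) (phi : {RV P >-> Y}) (g : Y -> R) :
  bounded_measurable g ->
  \int[distribution P phi]_y g y = \int[P]_x g (phi x).
Proof.
move=> [mg [M gM]]; rewrite /Rintegral integral_distribution//.
  exact/measurable_EFinP.
apply: (bounded_measurable_integrable P (g := g \o phi)); split.
  exact: measurableT_comp.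
by exists M => x; exact: gM.
Qed.

Lemma bounded_measurable_prodM d d' (X : measurableType d)
    (Y : measurableType d') (R : realType) (a : X -> R) (b : Y -> R) :
  bounded_measurable a -> bounded_measurable b ->
  bounded_measurable (fun z : X * Y => a z.1 * b z.2).
Proof.
move=> [ma [M aM]] [mb [N bN]].
apply: (bounded_measurableM (g := a \o fst) (h := b \o snd)); split.
- exact: measurableT_comp.
- by exists M => z; exact: aM.
- exact: measurableT_comp.
- by exists N => z; exact: bN.
Qed.

Lemma Rintegral_prodM d d' (X : measurableType d) (Y : measurableType d')
    (R : realType) (P : probability X R) (Q : probability Y R)
    (a : X -> R) (b : Y -> R) :
  bounded_measurable a -> bounded_measurable b ->
  \int[(P \x Q)%E]_z (a z.1 * b z.2) = \int[P]_x a x * \int[Q]_y b y.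
Proof.
move=> ba bb; have bab := bounded_measurable_prodM ba bb.
have ib := bounded_measurable_integrable Q bb.
rewrite /Rintegral -(integral12_prod_meas1 (bounded_measurable_integrable _ bab)).
rewrite /fubini_F.
transitivity (fine (\int[P]_x ((\int[Q]_y b y) * a x)%:E)%E).
  congr fine; apply: eq_integral => x _ /=.
  under eq_integral do rewrite EFinM.
  rewrite integralZl// mulrC EFinM /Rintegral fineK//.
  exact: integrable_fin_num.
rewrite mulrC -[LHS]/(\int[P]_x ((\int[Q]_y b y) * a x)) RintegralZl//.
exact: bounded_measurable_integrable.
Qed.

Section fourier_partition.
Context (R : realType).
Local Open Scope complex_scope.

Lemma fourierE n (P : probability (n.-tuple R) R) (t : n.-tuple R) :
  fourier P t =
  (\int[P]_x cos (dotp t x)) -i* (\int[P]_x sin (dotp t x)).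
Proof.
rewrite /fourier /Cintegral.
have cexpE x : cexp (- 'i * (dotp t x)%:C) = cos (dotp t x) -i* sin (dotp t x).
  rewrite (_ : - 'i * _ = 0 -i* dotp t x); last by simpc.
  by rewrite /cexp /= expR0 mul1r cosN sinN.
have -> : \int[P]_x complex.Re (cexp (- 'i * (dotp t x)%:C)) = \int[P]_x cos (dotp t x).
  by apply: eq_Rintegral => x _; rewrite cexpE.
have -> : \int[P]_x complex.Im (cexp (- 'i * (dotp t x)%:C)) =
    \int[P]_x (-1 * sin (dotp t x)).
  by apply: eq_Rintegral => x _; rewrite cexpE mulN1r.
rewrite RintegralZl ?mulN1r//.
by apply: bounded_measurable_integrable; exact: bounded_measurable_sin.
Qed.

Context (n : nat).
Implicit Types (F G : {set 'I_n}) (P Q : probability (n.-tuple R) R).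

Lemma dotp_proj F (t x : n.-tuple R) :
  dotp (Defs.proj F t) (Defs.proj F x) = dotp (zero_outside F t) x.
Proof.
transitivity (\sum_(i in F) tnth t i * tnth x i).
  by rewrite big_enum_val; apply: eq_bigr => k _; rewrite !tnth_mktuple.
rewrite big_mkcond; apply: eq_bigr => i _.
by rewrite tnth_mktuple; case: ifP => // _; rewrite mul0r.
Qed.

(** [merge] places [y] on the coordinates in [F] and takes the others from [x],
    so that the inner product splits along [F] and its complement. *)
Lemma dotp_merge F (t : n.-tuple R) (y : #|F|.-tuple R) (x : n.-tuple R) :
  dotp t (Defs.merge (y, x)) = dotp (Defs.proj F t) y + dotp (zero_outside (~: F) t) x.
Proof.
rewrite /dotp (bigID [in F])/=; congr (_ + _).
  rewrite big_enum_val; apply: eq_bigr => k _.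
  rewrite !tnth_mktuple /=; congr (_ * _).
  rewrite {1}(enum_val_nth (enum_val k)) index_uniq ?enum_uniq -?cardE//.
  exact/esym/tnth_nth.
rewrite big_mkcond; apply: eq_bigr => i _.
rewrite !tnth_mktuple /= inE; case: ifPn => [iF|]; last by rewrite mul0r.
by rewrite nth_default// size_tuple cardE leqNgt index_mem mem_enum.
Qed.

Lemma fourier_marginal F P (t : n.-tuple R) :
  fourier (marginal P F) (Defs.proj F t) = fourier P (zero_outside F t).
Proof.
rewrite !fourierE !Rintegral_distribution; last 2 first.
- exact: bounded_measurable_sin.
- exact: bounded_measurable_cos.
by congr (_ -i* _); apply: eq_Rintegral => x _; rewrite dotp_proj.
Qed.

(** The addition formulas split the character into products of functions of
    the two components, to which Fubini's theorem applies. *)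
Lemma fourier_merge F (Q1 : probability (#|F|.-tuple R) R) Q
    (t : n.-tuple R) :
  fourier (distribution (Q1 \x Q)%E (Defs.merge (F := F))) t =
  fourier Q1 (Defs.proj F t) * fourier Q (zero_outside (~: F) t).
Proof.
set u := Defs.proj F t; set v := zero_outside (~: F) t.
have bcu := bounded_measurable_cos u; have bsu := bounded_measurable_sin u.
have bcv := bounded_measurable_cos v; have bsv := bounded_measurable_sin v.
have int a b (ba : bounded_measurable a) (bb : bounded_measurable b) :=
  bounded_measurable_integrable (Q1 \x Q)%E (bounded_measurable_prodM ba bb).
rewrite !fourierE !Rintegral_distribution; last 2 first.
- exact: bounded_measurable_sin.
- exact: bounded_measurable_cos.
have -> : \int[(Q1 \x Q)%E]_z cos (dotp t (Defs.merge z)) =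
    \int[(Q1 \x Q)%E]_z (cos (dotp u z.1) * cos (dotp v z.2) -
                         sin (dotp u z.1) * sin (dotp v z.2)).
  by apply: eq_Rintegral => -[y x] _; rewrite dotp_merge cosD.
have -> : \int[(Q1 \x Q)%E]_z sin (dotp t (Defs.merge z)) =
    \int[(Q1 \x Q)%E]_z (sin (dotp u z.1) * cos (dotp v z.2) +
                         cos (dotp u z.1) * sin (dotp v z.2)).
  by apply: eq_Rintegral => -[y x] _; rewrite dotp_merge sinD.
rewrite (RintegralB measurableT (int _ _ bcu bcv) (int _ _ bsu bsv)).
rewrite (RintegralD measurableT (int _ _ bsu bcv) (int _ _ bcu bsv)).
rewrite (Rintegral_prodM Q1 Q bcu bcv) (Rintegral_prodM Q1 Q bsu bsv).
rewrite (Rintegral_prodM Q1 Q bsu bcv) (Rintegral_prodM Q1 Q bcu bsv).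
by simpc; congr (_ +i* _); ring.
Qed.

Lemma zero_outside_disjoint F G (t : n.-tuple R) : [disjoint G & F]%B ->
  zero_outside G (zero_outside (~: F) t) = zero_outside G t.
Proof.
move=> /pred0P GF; apply: eq_from_tnth => i; rewrite !tnth_mktuple inE.
by case: ifP => // iG; have := GF i; rewrite /= iG /= => ->.
Qed.

Lemma fourier_dirac0 (t : n.-tuple R) :
  fourier (@dirac _ (n.-tuple R) [tuple (0 : R) | _ < n] R) t = 1.
Proof.
rewrite fourierE /Rintegral !integral_dirac//.
- rewrite !diracT !mul1e /=.
  have -> : dotp t [tuple 0 | _ < n] = 0.
    by rewrite /dotp big1// => i _; rewrite tnth_mktuple mulr0.
  by rewrite cos0 sin0 oppr0.
- by apply/measurable_EFinP; case: (bounded_measurable_sin t).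
- by apply/measurable_EFinP; case: (bounded_measurable_cos t).
Qed.

(** Peeling off the block [F] evaluates the remaining factors at the restriction
    of [t] to the complement of [F]; disjointness of the blocks makes this
    restriction invisible to them. *)
Lemma fourier_prod_marginals P (s : seq {set 'I_n}) (t : n.-tuple R) :
    uniq s -> finset.trivIset [set F in s]%SET ->
  fourier (prod_marginals P s) t = \prod_(F <- s) fourier P (zero_outside F t).
Proof.
elim: s t => [|F s IHs] t /=.
  by move=> _ _; rewrite big_nil fourier_dirac0.
move=> /andP[Fs us] tI; rewrite big_cons fourier_merge fourier_marginal.
congr (_ * _); rewrite IHs//; last first.
  by apply: finset.trivIsetS tI; apply/fintype.subsetP => G; rewrite !inE => ->; rewrite orbT.
apply: eq_big_seq => G Gs; rewrite zero_outside_disjoint//.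
have GF : G != F by apply: contraNneq Fs => <-.
by apply: (finset.trivIsetP tI) => //; rewrite !inE ?eqxx// Gs orbT.
Qed.

Lemma fourier_partition_measure P (pi : setpart n) (t : n.-tuple R) :
  fourier (partition_measure P pi) t = partition_fun (fourier P) pi t.
Proof.
have /and3P[_ tI _] := setpartP pi.
rewrite fourier_prod_marginals ?enum_uniq//; first by rewrite big_enum.
by rewrite (_ : [set F in _]%SET = blocks pi)//; apply/finset.setP => F; rewrite !inE mem_enum.
Qed.

End fourier_partition.

Local Open Scope classical_set_scope.
Local Open Scope ring_scope.

Theorem lemma7p1 (R : realType) (n : nat) (T : {set setpart n})
    (hT : lower_set T) (P : probability (n.-tuple R) R)
    (f : n.-tuple R -> R[i]) (hf : fourier P = f) :
  (forall A : set (n.-tuple R), measurable A -> lower_set_measure T P A = 0%E)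
  <->
  (forall t : n.-tuple R,
     \sum_(pi in T) (mobius T pi (hat1 n))%:~R * partition_fun f pi t = 0).
Proof.
pose c (pi : setpart n) : R := (mobius T pi (hat1 n))%:~R.
pose L := signed_integral T c (partition_measure P).
have sumE t : \sum_(pi in T) (mobius T pi (hat1 n))%:~R * partition_fun f pi t =
    (L (fun x => cos (dotp t x)) -i* L (fun x => sin (dotp t x)))%C.
  rewrite /L /signed_integral.
  transitivity (\sum_(pi in T) ((c pi)%:C * fourier (partition_measure P pi) t)%C).
    apply: eq_bigr => pi _; rewrite -hf fourier_partition_measure.
    by rewrite /c rmorph_int.
  under eq_bigr do rewrite fourierE.
  rewrite -sumrN.
  elim/big_rec3: _ => [|pi u v w _ ->]; first by [].
  by simpc; congr (_ +i* _)%C; ring.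
split=> [TP0 t|f0].
- have c0 : L (fun x => cos (dotp t x)) = 0.
    by apply: signed_integral_eq0 (bounded_measurable_cos t) => A /TP0.
  have s0 : L (fun x => sin (dotp t x)) = 0.
    by apply: signed_integral_eq0 (bounded_measurable_sin t) => A /TP0.
  by rewrite sumE c0 s0 oppr0.
- apply: signed_fourier_uniqueness => t.
  by have := f0 t; rewrite sumE => /eqP; rewrite eq_complex /= oppr_eq0 => /andP[/eqP ? /eqP ?].
Qed.
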